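(* Let $f(x)$ be a real-valued univariate function that is $(n+2)$-times differentiable, let $x_0<x_1<\cdots<x_n$ be nodes, and let $P_n(x)$ be the Lagrange interpolating polynomial of degree at most $n$ with $P_n(x_k)=f(x_k)$ for $k=0,1,\ldots,n$. Let $Q_n(x)=\prod_{k=0}^{n}(x-x_k)$, and let $\xi(x)$ be the Rolle function, that is, the function with $x_0<\xi(x)<x_n$ appearing in the pointwise error formula on $[x_0,x_n]$, $$f(x)-P_n(x)=\frac{f^{(n+1)}(\xi(x))}{(n+1)!}\,Q_n(x).$$ Then $$\frac{d\xi}{dx}=\frac{(n+1)!\,\bigl(f'(x)-P_n'(x)\bigr)-f^{(n+1)}(\xi)\,Q_n'(x)}{Q_n(x)\,f^{(n+2)}(\xi)},$$ and, if a particular value $\xi_z=\xi(x_z)$ is available, this differential equation together with that value is an initial-value problem that can, in principle, be solved to yield the Rolle function $\xi(x)$.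
   Context: The error formula for Lagrange interpolation is derived by invoking Rolle's Theorem; a value of $\xi$ is called a Rolle number and $\xi(x)$ is called the Rolle function. Primes denote differentiation with respect to $x$. The factor $f^{(n+1)}(\xi)$ denotes the $(n+1)$th derivative of $f(\xi)$ with respect to $\xi$, and similarly for $f^{(n+2)}(\xi)$. The differential equation is obtained by multiplying the error formula by $(n+1)!$, differentiating with respect to $x$ and solving for $d\xi/dx$.
   Formalization: The Rolle function ξ is assumed continuous (at x, or on the interval of the initial-value problem), since a pointwise choice of ξ may jump; Q_n(x) and f^(n+2)(ξ) are assumed nonzero where the formula divides by them, and at nodes solutions of the IVP need only be continuous. *)

(* Defs.v *)
From mathcomp Require Import all_boot all_order all_algebra.
From mathcomp Require Import all_classical all_reals all_analysis.

Set Implicit Arguments.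
Unset Strict Implicit.
Unset Printing Implicit Defensive.

Import Order.TTheory GRing.Theory Num.Theory.
Import numFieldNormedType.Exports.

Local Open Scope classical_set_scope.
Local Open Scope ring_scope.

Section RolleFunction.
Variables (R : realType) (n : nat).
Implicit Types (xs : 'I_n.+1 -> R) (f xi y : R -> R) (P : {poly R}).

(* Meaningful for open [D]: [f^`(k)] is a total function that is only a genuine
   derivative where the preceding one is derivable. *)
Definition times_differentiable_on (m : nat) (D : set R) f : Prop :=
  forall k, (k < m)%N -> forall t, D t -> derivable (f^`(k)%classic) t 1.

Definition lagrange_interpolant xs f P : Prop :=
  (size P <= n.+1)%N /\ forall k, P.[xs k] = f (xs k).

Definition node_prod xs (x : R) : R := \prod_(k < n.+1) (x - xs k).

(* At a node the error formula reads 0 = 0, so it constrains [xi] there only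
   through the bounds. *)
Definition rolle_function xs f P xi : Prop :=
  forall x, xs ord0 <= x <= xs ord_max ->
    xs ord0 < xi x < xs ord_max /\
    f x - P.[x] = f^`(n.+1)%classic (xi x) / (n.+1)`!%:R * node_prod xs x.

Definition rolle_rhs xs f P (x z : R) : R :=
  ((n.+1)`!%:R * (f^`()%classic x - (horner P)^`()%classic x)
   - f^`(n.+1)%classic z * (node_prod xs)^`()%classic x)
  / (node_prod xs x * f^`(n.+2)%classic z).

(* [y] solves dy/dx = rolle_rhs xs f P x y, y(xz) = yz on the interval [J].  The
   right-hand side has the singular denominator [node_prod xs x] at the nodes:
   there, as at the endpoints of [J], continuity of [y] replaces the equation, so
   that [J] may be all of [x_0, x_n] and [xz] may be a node. *)
Definition rolle_ivp_solution xs f P (D J : set R) (xz yz : R) y : Prop :=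
  [/\ {within J, continuous y},
      forall x, J x -> D (y x) /\ f^`(n.+2)%classic (y x) != 0,
      forall x, J^° x -> node_prod xs x != 0 ->
        is_derive x 1 y (rolle_rhs xs f P x (y x))
    & y xz = yz].

End RolleFunction.

(* Main.v *)
(** With [G := f^(n+1)] and [e := (n+1)! (f - P)], the error formula reads
    [Q x * G (xi x) = e x].

    Off the nodes, [G \o xi = e / Q] is differentiable, so continuity of [xi]
    and [G' (xi x) != 0] give the derivative of [xi] by Carathéodory's criterion.

    For uniqueness, a solution [y] makes [Q * (G \o y) - e] continuous with zero
    derivative off the finitely many nodes, hence constant, and it vanishes at
    [xz]; so [G \o y = G \o xi] off the nodes, and everywhere by continuity.  Both
    [y] and [xi] lift this function through [G] and agree at [xz]; as [G'] does
    not vanish on the union of their ranges, which is an interval, [G] is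
    injective there by Rolle's theorem. *)
Require Import Defs.
From mathcomp Require Import all_boot all_order all_algebra.
From mathcomp Require Import all_classical all_reals all_analysis.
From mathcomp Require Import ring.

Set Implicit Arguments.
Unset Strict Implicit.
Unset Printing Implicit Defensive.

Import Order.TTheory GRing.Theory Num.Theory.
Import numFieldNormedType.Exports.

Local Open Scope classical_set_scope.
Local Open Scope ring_scope.

(** * Real calculus: implicit differentiation, constancy, uniqueness of lifts *)

Section Calculus.
Variable R : realType.
Implicit Types (f g u v : R -> R) (J : set R) (s : seq R).

Lemma is_derive_derive1 f x : derivable f x 1 -> is_derive x 1 f (f^`()%classic x).
Proof. by move=> fx; rewrite derive1E; exact: derivableP. Qed.

Lemma derivable_cts f x : derivable f x 1 -> {for x, continuous f}.
Proof. by move=> /derivable1_diffP/differentiable_continuous. Qed.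

Lemma within_continuous_interior f J x :
  {within J, continuous f} -> J° x -> {for x, continuous f}.
Proof.
move=> /subspace_continuousP fJ Jx.
by have := fJ x (interior_subset Jx); rewrite within_interior.
Qed.

Lemma within_continuous_comp g u J :
  {within J, continuous u} -> (forall x, J x -> {for u x, continuous g}) ->
  {within J, continuous (g \o u)}.
Proof.
move=> /subspace_continuousP uJ gu; apply/subspace_continuousP => x Jx.
exact: (cvg_comp _ _ (uJ x Jx) (gu x Jx)).
Qed.

(* Carathéodory's form of the derivative turns [g t - g x = G (u t) - G (u x)]
   into [k t * (t - x) = h (u t) * (u t - u x)] with [h (u x) = dG] nonzero. *)
Lemma is_derive_implicit (G g u : R -> R) (x dG dg : R) :
  is_derive (u x) 1 G dG -> dG != 0 -> {for x, continuous u} ->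
  (\near x, G (u x) = g x) -> is_derive x 1 g dg ->
  is_derive x 1 u (dg / dG).
Proof.
move=> /is_derive1_caratheodory[h [hE hC hx]] dG0 uC Gu.
move=> /is_derive1_caratheodory[k [kE kC kx]].
have hu : (h \o u) t @[t --> x] --> dG by rewrite -hx; exact: cvg_comp uC hC.
apply/is_derive1_caratheodory.
exists (fun t => if t == x then dg / dG else (u t - u x) / (t - x)); split.
- move=> z; case: eqP => [->|/eqP]; first by rewrite !subrr mulr0.
  by rewrite -subr_eq0 => /divfK.
- rewrite /prop_for /continuous_at eqxx.
  (* Near [x] the difference quotient of [u] equals [k t / h (u t)], since [h (u t)] stays nonzero
     there; so it inherits this limit. *)
  have kh : (k t / h (u t)) @[t --> x] --> dg / dG.
    by apply: cvgM; [rewrite -kx; exact: kC|exact: cvgV].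
  apply: cvg_trans kh; apply: near_eq_cvg; near=> t.
  case: eqP => [->|/eqP tx]; first by rewrite kx hx.
  have ht : h (u t) != 0.
    near: t; apply: (cvgr_neq0 dG) => //; exact: hu.
  have := kE t.
  rewrite -(nbhs_singleton Gu).
  have <- : G (u t) = g t by near: t.
  rewrite hE => e.
  have tx0 : t - x != 0 by rewrite subr_eq0.
  by apply: (mulIf tx0); rewrite divfK// mulrAC -e mulrC mulrA mulVf// mul1r.
- by rewrite eqxx.
Unshelve. all: by end_near. Qed.

(** Induction on the exceptional points: one inside the interval splits it in two, glued by
    continuity; one outside is dropped; with none left, the mean value theorem applies. *)
Lemma eq_off_seq s f (a b : R) : a <= b -> {within `[a, b], continuous f} ->
  (forall x, a < x < b -> x \notin s -> is_derive x 1 f 0) -> f a = f b.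
Proof.
elim: s a b => [|c s IHs] a b; rewrite le_eqVlt => /predU1P[-> //|ab] fC df.
  have [||c _] := @MVT _ f (fun=> 0) a b ab; last 2 first.
  - by [].
  - by rewrite mul0r => /eqP; rewrite subr_eq0 => /eqP.
  - by move=> x; rewrite in_itv => xab; exact: df.
have [/andP[ac cb]|cab] := boolP (a < c < b).
  transitivity (f c); apply: IHs; rewrite ?ltW//.
  - by apply: continuous_subspaceW fC; apply: subset_itvl; rewrite bnd_simp ltW.
  - move=> x /andP[ax xc] xs; apply: df; first by rewrite ax (lt_trans xc).
    by rewrite inE negb_or xs lt_eqF.
  - by apply: continuous_subspaceW fC; apply: subset_itvr; rewrite bnd_simp ltW.
  - move=> x /andP[cx xb] xs; apply: df; first by rewrite xb (lt_trans ac).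
    by rewrite inE negb_or xs gt_eqF.
apply: IHs; rewrite ?ltW// => x xab xs; apply: df => //.
by rewrite inE negb_or xs andbT; apply: contraNneq cab => <-.
Qed.

Lemma interval_subset_itvcc J (a b : R) :
  is_interval J -> J a -> J b -> `[a, b]%classic `<=` J.
Proof. by move=> iJ Ja Jb x /=; rewrite in_itv; exact: iJ. Qed.

Lemma eq_on_interval_off_seq s f J (a b : R) : is_interval J ->
  {within J, continuous f} ->
  (forall x, J° x -> x \notin s -> is_derive x 1 f 0) ->
  J a -> J b -> f a = f b.
Proof.
move=> iJ fC df; wlog ab : a b / a <= b => [wl Ja Jb|Ja Jb].
  by case: (leP a b) => [|/ltW] /wl ->.
apply: (@eq_off_seq s) => //.
  by apply: continuous_subspaceW fC; exact: interval_subset_itvcc.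
move=> x xab xs; apply: df => //.
(* The open interval between [a] and [b] is a neighbourhood of [x] contained in [J]. *)
apply: filterS (near_in_itvoo (x := x) (a := a) (b := b) _); last by rewrite in_itv.
by move=> y /= /subset_itv_oo_cc; exact: interval_subset_itvcc.
Qed.

Lemma within_continuous_ivt u J (a b t : R) : is_interval J ->
  {within J, continuous u} -> J a -> J b -> u a <= t <= u b ->
  exists2 c, J c & u c = t.
Proof.
move=> iJ uC Ja Jb uab.
have IVT_J c d : c <= d -> J c -> J d ->
    Num.min (u c) (u d) <= t <= Num.max (u c) (u d) -> exists2 e, J e & u e = t.
  move=> cd Jc Jd tcd.
  have sJ := interval_subset_itvcc iJ Jc Jd.
  have [e ecd <-] := IVT cd (continuous_subspaceW sJ uC) tcd.
  by exists e => //; exact: sJ.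
have tab : Num.min (u a) (u b) <= t <= Num.max (u a) (u b).
  have /andP[at_ tb] := uab.
  by rewrite ge_min at_ le_max tb orbT.
case: (leP a b) => [/IVT_J|/ltW/IVT_J]; apply => //.
by rewrite minC maxC.
Qed.

(* The ranges of [u] and [v] are intervals sharing [u z], so the derivative of
   [G] vanishes nowhere between [u x] and [v x], and Rolle's theorem applies;
   no continuity of that derivative is involved. *)
Lemma lift_unique (G u v : R -> R) J (z x : R) : is_interval J ->
  {within J, continuous u} -> {within J, continuous v} ->
  (forall t, J t -> derivable G (u t) 1 /\ G^`()%classic (u t) != 0) ->
  (forall t, J t -> derivable G (v t) 1 /\ G^`()%classic (v t) != 0) ->
  J z -> u z = v z -> J x -> G (u x) = G (v x) -> u x = v x.
Proof.
move=> iJ; wlog uv : u v / u x < v x => [wl uC vC Gu Gv Jz uvz Jx Guv|].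
  have [uv|vu|//] := ltgtP (u x) (v x); first exact: wl.
  by apply/esym; apply: wl.
move=> uC vC Gu Gv Jz uvz Jx Guv.
have Guv_itv t : t \in `[u x, v x] -> derivable G t 1 /\ G^`()%classic t != 0.
  (* The common value [u z = v z] is the cut: above it [t] lies between [v z] and [v x], hence is a
     value of [v]; below it, between [u x] and [u z], hence a value of [u]. *)
  rewrite in_itv /= => /andP[ut tv]; have [zt|tz] := leP (v z) t.
    have [|c Jc <-] := within_continuous_ivt iJ vC Jz Jx (t := t); last exact: Gv.
    by rewrite zt tv.
  have [|c Jc <-] := within_continuous_ivt iJ uC Jx Jz (t := t); last exact: Gu.
  by rewrite ut uvz ltW.
have [||//|c cuv [_ dG0]] := @Rolle _ G _ _ uv.
- by move=> t /subset_itv_oo_cc /Guv_itv[].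
- by apply: derivable_within_continuous => t /Guv_itv[].
- have [_] := Guv_itv c (subset_itv_oo_cc cuv).
  by rewrite derive1E dG0 eqxx.
Qed.

End Calculus.

(** * The error formula and the derivative of the Rolle function *)

Section RolleFunction.
Variables (R : realType) (n : nat) (xs : 'I_n.+1 -> R).

Lemma node_prod_neq0 x : (node_prod xs x != 0) = (x \notin codom xs).
Proof.
rewrite /node_prod; apply/prodf_neq0/idP => [xk|xNcodom k _].
  by apply/codomP => -[k xE]; have := xk k isT; rewrite xE subrr eqxx.
rewrite subr_eq0; apply: contraNneq xNcodom => ->; exact: codom_f.
Qed.

Lemma derivable_node_prod x : derivable (node_prod xs) x 1.
Proof.
have -> : node_prod xs = horner (\prod_(k < n.+1) ('X - (xs k)%:P)).
  apply/funext => t; rewrite /node_prod horner_prod.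
  by apply: eq_bigr => k _; rewrite hornerXsubC.
exact: derivable_horner.
Qed.

Lemma near_node_prod_neq0 x :
  node_prod xs x != 0 -> \near x, node_prod xs x != 0.
Proof.
move=> Qx.
exact: (cvgr_neq0 _ (derivable_cts (@derivable_node_prod x)) Qx).
Qed.

(** Both endpoints are nodes, so being off the nodes excludes them. *)
Lemma node_prod_neq0_itvoo x : xs ord0 <= x <= xs ord_max ->
  node_prod xs x != 0 -> x \in `]xs ord0, xs ord_max[.
Proof.
rewrite node_prod_neq0 in_itv /= !lt_neqAle => /andP[-> ->] xN.
by rewrite !andbT; apply/andP; split;
  [apply: contraNneq xN => <-|apply: contraNneq xN => ->]; exact: codom_f.
Qed.

Variables (D : set R) (f : R -> R) (P : {poly R}) (xi : R -> R).
Hypothesis D_nodes : forall t, xs ord0 <= t <= xs ord_max -> D t.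
Hypothesis f_diff : times_differentiable_on n.+2 D f.
Hypothesis xi_rolle : rolle_function xs f P xi.

Let G := f^`(n.+1)%classic.

Let G_derivable t : D t -> derivable G t 1.
Proof. exact: f_diff. Qed.

Let scaled_error x := (n.+1)`!%:R * (f x - P.[x]).

Let is_derive_scaled_error x : D x ->
  is_derive x 1 scaled_error
    ((n.+1)`!%:R * (f^`()%classic x - (horner P)^`()%classic x)).
Proof.
move=> Dx.
have df : is_derive x 1 f (f^`()%classic x).
  by apply: is_derive_derive1; exact: (f_diff (k := 0)).
have dP := is_derive_derive1 (@derivable_horner _ P x).
rewrite -[X in is_derive _ _ _ X]/(_ *: _).
exact: is_deriveZ.
Qed.

(** Not dividing by [node_prod xs x] keeps the identity usable at the nodes, in particular at an
    initial point [xz] that is a node. *)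
Lemma rolle_function_scaled x : xs ord0 <= x <= xs ord_max ->
  node_prod xs x * G (xi x) = scaled_error x.
Proof.
move=> /xi_rolle[_ fP].
by rewrite /scaled_error fP mulrA mulrC mulrCA divff ?mulr1// pnatr_eq0 -lt0n fact_gt0.
Qed.

Lemma rolle_function_range x : xs ord0 <= x <= xs ord_max -> D (xi x).
Proof. by move=> /xi_rolle[/andP[? ?] _]; apply: D_nodes; rewrite !ltW. Qed.

Lemma is_derive_rolle_function x : xs ord0 <= x <= xs ord_max ->
  node_prod xs x != 0 -> f^`(n.+2)%classic (xi x) != 0 ->
  {for x, continuous xi} -> is_derive x 1 xi (rolle_rhs xs f P x (xi x)).
Proof.
move=> x_itv Qx dG0 xiC.
have dG : is_derive (xi x) 1 G (f^`(n.+2)%classic (xi x)).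
  exact/is_derive_derive1/G_derivable/rolle_function_range.
have de := is_derive_scaled_error (D_nodes x_itv).
have dQ := is_derive_derive1 (@derivable_node_prod x).
have Gxi : \near x, G (xi x) = scaled_error x * (node_prod xs x)^-1.
  near=> t.
  have Qt : node_prod xs t != 0.
    by near: t; exact: near_node_prod_neq0.
  have t_itv : t \in `]xs ord0, xs ord_max[.
    by near: t; exact/near_in_itvoo/node_prod_neq0_itvoo.
  rewrite -rolle_function_scaled; last exact: subset_itv_oo_cc t_itv.
  by rewrite mulrAC divff ?mul1r.
have := is_derive_implicit dG dG0 xiC Gxi (is_deriveM de (is_deriveV Qx dQ)).
move=> /is_derive_eq; apply.
(* The quotient rule leaves a term in the error itself; trading it for [node_prod xs x * G (xi x)]
   cancels one factor of the node product. *)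
rewrite -rolle_function_scaled // /rolle_rhs -/G /GRing.scale /=.
by field; rewrite Qx dG0.
Unshelve. all: by end_near. Qed.

(** * The initial-value problem: existence and uniqueness *)

Variables (J : set R) (xz : R).
Hypothesis J_itv : is_interval J.
Hypothesis J_nodes : forall x, J x -> xs ord0 <= x <= xs ord_max.
Hypothesis Jxz : J xz.
Hypothesis xi_cts : {within J, continuous xi}.
Hypothesis dG_xi : forall x, J x -> f^`(n.+2)%classic (xi x) != 0.

Lemma rolle_function_ivp_solution : rolle_ivp_solution xs f P D J xz (xi xz) xi.
Proof.
split => // [x Jx|x Jx Qx].
  by split; [exact/rolle_function_range/J_nodes|exact: dG_xi].
have Jx' := interior_subset Jx.
apply: is_derive_rolle_function => //; [exact: J_nodes|exact: dG_xi|].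
exact: within_continuous_interior xi_cts Jx.
Qed.

(* The equation says exactly that [node_prod xs x * G (y x) - scaled_error x]
   has derivative 0 off the nodes, so the error formula persists along [y]. *)
Lemma rolle_ivp_solution_scaled y :
  rolle_ivp_solution xs f P D J xz (xi xz) y ->
  forall x, J x -> node_prod xs x * G (y x) = scaled_error x.
Proof.
case=> yC Dy dy yxz x Jx; apply/eqP; rewrite -subr_eq0; apply/eqP.
pose L t := node_prod xs t * G (y t) - scaled_error t.
have GyC : {within J, continuous (G \o y)}.
  apply: within_continuous_comp yC _ => t /Dy[Dyt _].
  exact/derivable_cts/G_derivable.
rewrite -[LHS]/(L x).
transitivity (L xz); last first.
  by rewrite /L yxz rolle_function_scaled ?subrr//; exact: J_nodes.
apply: (@eq_on_interval_off_seq _ (codom xs) L J) => //.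
  apply/subspace_continuousP => t Jt.
  have Dt := D_nodes (J_nodes Jt).
  apply: cvgB; first apply: cvgM.
  - apply: cvg_within_filter.
    exact/derivable_cts/derivable_node_prod.
  - by move/subspace_continuousP : GyC; exact.
  - apply: cvg_within_filter; apply: derivable_cts.
    by case: (is_derive_scaled_error Dt).
move=> t Jt; rewrite -node_prod_neq0 => Qt.
have Jt' := interior_subset Jt.
have [Dyt dG0] := Dy _ Jt'.
have dG := is_derive_derive1 (G_derivable Dyt).
have dyt := dy _ Jt Qt.
have de := is_derive_scaled_error (D_nodes (J_nodes Jt')).
have dQ := is_derive_derive1 (@derivable_node_prod t).
have := is_deriveB (is_deriveM dQ (is_derive1_comp dG dyt)) de.
move=> /is_derive_eq; apply.
rewrite /rolle_rhs -/G /GRing.scale /= -[G^`()%classic]/(f^`(n.+2)%classic).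
by field; rewrite Qt dG0.
Qed.

Lemma rolle_ivp_solution_unique y :
  rolle_ivp_solution xs f P D J xz (xi xz) y -> forall x, J x -> y x = xi x.
Proof.
move=> ysol x Jx; have [yC Dy _ yxz] := ysol.
have Gy t : J t -> derivable G (y t) 1 /\ G^`()%classic (y t) != 0.
  by move=> /Dy[/G_derivable].
have Gxi t : J t -> derivable G (xi t) 1 /\ G^`()%classic (xi t) != 0.
  move=> Jt; split; last exact: dG_xi.
  exact/G_derivable/rolle_function_range/J_nodes.
have cG u : {within J, continuous u} ->
    (forall t, J t -> derivable G (u t) 1 /\ G^`()%classic (u t) != 0) ->
    {within J, continuous (G \o u)}.
  move=> uC Gu; apply: within_continuous_comp uC _ => t /Gu[+ _].
  exact: derivable_cts.
apply: (lift_unique J_itv yC xi_cts Gy Gxi Jxz yxz Jx).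
apply/eqP; rewrite -subr_eq0; apply/eqP.
(* As [x] may be a node, the node product cannot be cancelled at [x] itself; [K] is carried there
   from [xz] as a continuous function with zero derivative off the nodes. *)
pose K t := G (y t) - G (xi t).
rewrite -[LHS]/(K x); transitivity (K xz); last by rewrite /K yxz subrr.
apply: (@eq_on_interval_off_seq _ (codom xs) K J) => //.
  apply/subspace_continuousP => t Jt.
  apply: cvgB.
    by move/subspace_continuousP : (cG _ yC Gy); exact.
  by move/subspace_continuousP : (cG _ xi_cts Gxi); exact.
move=> t Jt; rewrite -node_prod_neq0 => Qt.
(* Around a point off the nodes both scaled formulas hold and the node product cancels, so [K] is
   locally zero. *)
apply: near_eq_is_derive (is_derive_cst 0 t 1).
near=> r.
have Jr : J r by near: r; exact: Jt.
have Qr : node_prod xs r != 0 by near: r; exact: near_node_prod_neq0.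
apply/esym/eqP; rewrite subr_eq0; apply/eqP/(mulfI Qr).
by rewrite (rolle_ivp_solution_scaled ysol Jr) rolle_function_scaled//; exact: J_nodes.
Unshelve. all: by end_near. Qed.

End RolleFunction.

Theorem mainTheorem1 (R : realType) (n : nat) (xs : 'I_n.+1 -> R) (D : set R)
    (f : R -> R) (P : {poly R}) (xi : R -> R)
    (xs_incr : forall i j : 'I_n.+1, (i < j)%N -> xs i < xs j)
    (D_open : open D)
    (D_nodes : forall t, xs ord0 <= t <= xs ord_max -> D t)
    (f_diff : times_differentiable_on n.+2 D f)
    (P_lagrange : lagrange_interpolant xs f P)
    (xi_rolle : rolle_function xs f P xi) :
  (forall x : R, xs ord0 <= x <= xs ord_max -> node_prod xs x != 0 ->
     f^`(n.+2)%classic (xi x) != 0 -> {for x, continuous xi} ->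
     is_derive x 1 xi
       (((n.+1)`!%:R * (f^`()%classic x - (horner P)^`()%classic x)
         - f^`(n.+1)%classic (xi x) * (node_prod xs)^`()%classic x)
        / (node_prod xs x * f^`(n.+2)%classic (xi x))))
  /\
  (forall (J : set R) (xz : R), is_interval J ->
     (forall x, J x -> xs ord0 <= x <= xs ord_max) -> J xz ->
     {within J, continuous xi} ->
     (forall x, J x -> f^`(n.+2)%classic (xi x) != 0) ->
     rolle_ivp_solution xs f P D J xz (xi xz) xi /\
     (forall y : R -> R, rolle_ivp_solution xs f P D J xz (xi xz) y ->
        forall x, J x -> y x = xi x)).
Proof.
split=> [x x_itv Qx dG0 xiC|J xz J_itv J_nodes Jxz xi_cts dG0].
  exact: (is_derive_rolle_function D_nodes f_diff xi_rolle).
split; first exact: (rolle_function_ivp_solution D_nodes f_diff xi_rolle).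
exact: (rolle_ivp_solution_unique D_nodes f_diff xi_rolle).
Qed.
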